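(* Let $G$ be an infinite finitely generated group with word length $L$, and let $\sigma\colon\mathbb{N}_0\to[1,\infty)$ be an almost submultiplicative growth function with $(1+n)\preccurlyeq\sigma$. Then the following statements are equivalent: (i) $\beta_G\preccurlyeq\sigma$. (ii) There exists $R\ge0$ such that the series $F_L(z)=\sum_{g\in G}\mathsf{e}_g z^{L(g)}$ converges absolutely for all $z\in\mathbb{C}$ with $|z|\le1$ with respect to $\|\cdot\|_{\ell^\infty,L,\sigma,-R}$, i.e. $\sum_{g\in G}\|\mathsf{e}_g z^{L(g)}\|_{\ell^\infty,L,\sigma,-R}<\infty$ for all $|z|\le1$.
   Context: Fix a finite generating set $S=S^{-1}$ of $G$; the word length $L(g)\in\mathbb{N}_0$ is the minimal number of elements of $S$ needed to write $g$ as a product, $L(e)=0$. The volume growth is $\beta_G(n)=\#\{g\in G:L(g)\le n\}$. A growth function is a map $\sigma\colon\mathbb{N}_0\to[1,\infty)$ that is monotonically increasing ($\sigma(n)\le\sigma(n+1)$) and unbounded. It is almost submultiplicative if for every $\epsilon>0$ there is $c>0$ with $\sigma(n+m)\le c\,\sigma(n)^{1+\epsilon}\sigma(m)^{1+\epsilon}$ for all $n,m\in\mathbb{N}_0$. For maps $\sigma,\sigma'\colon\mathbb{N}_0\to[1,\infty)$ write $\sigma\preccurlyeq\sigma'$ if there are an integer $c\ge1$ and a real $k\ge1$ with $\sigma(n)\le c\,\sigma'(cn)^k$ for all $n\in\mathbb{N}_0$; $(1+n)$ denotes the function $n\mapsto1+n$. $\mathbb{C}[[G]]$ is the space of all formal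 series $b=\sum_{g\in G}b_g\mathsf{e}_g$, $b_g\in\mathbb{C}$, and $\|b\|_{\ell^\infty,L,\sigma,-R}=\sup_{g\in G}|b_g|/\sigma(L(g))^R\in[0,\infty]$. $F_L$ is called the complete growth function of $G$ with respect to $L$. Convention: $z^0=1$. *)

(* Defs.v *)
From HB Require Import structures.
From mathcomp Require Import all_boot all_order all_algebra.
From mathcomp Require Import finmap.
From mathcomp Require Import all_classical all_reals all_analysis.
From mathcomp Require Import complex.

Set Implicit Arguments.
Unset Strict Implicit.
Unset Printing Implicit Defensive.

Import Order.TTheory GRing.Theory Num.Theory.

Local Open Scope classical_set_scope.
Local Open Scope ring_scope.
Local Open Scope complex_scope.

Definition is_subgroup (G : groupType) (H : set G) : Prop :=
  [/\ H 1%g, forall x y, H x -> H y -> H (x * y)%g & forall x, H x -> H (x^-1)%g].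

Definition generates (G : groupType) (S : {fset G}) : Prop :=
  smallest (@is_subgroup G) [set` S] = [set: G].

Definition symmetric_set (G : groupType) (S : {fset G}) : Prop :=
  S = [fset (x^-1)%g | x in S]%fset.

Definition spelled (G : groupType) (S : {fset G}) (g : G) (n : nat) : Prop :=
  exists w : seq G,
    [/\ size w = n, {subset w <= S} & (\prod_(x <- w) x)%g = g].

(* The default value 0 is only reached when g is not a product of elements
   of S, which cannot happen for a symmetric generating set. *)
Definition word_length (G : groupType) (S : {fset G}) (g : G) : nat :=
  xget 0%N [set n | spelled S g n /\
                    forall m, spelled S g m -> (n <= m)%N].

(* Balls are finite since S is, so that fset_set is not used outside of its
   meaningful domain. *)
Definition volume_growth (R : realType) (G : groupType) (S : {fset G})
  (n : nat) : R :=
  (#|` fset_set [set g : G | (word_length S g <= n)%N] |)%:R.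

Definition growth_function (R : realType) (sigma : nat -> R) : Prop :=
  [/\ forall n, 1 <= sigma n,
      forall n, sigma n <= sigma n.+1 &
      forall M : R, exists n, M < sigma n].

Definition almost_submultiplicative (R : realType) (sigma : nat -> R) : Prop :=
  forall eps : R, 0 < eps -> exists c : R, 0 < c /\
    forall n m : nat,
      sigma (n + m)%N <= c * sigma n `^ (1 + eps) * sigma m `^ (1 + eps).

Definition growth_le (R : realType) (sigma sigma' : nat -> R) : Prop :=
  exists (c : nat) (k : R), [/\ (1 <= c)%N, 1 <= k &
    forall n : nat, sigma n <= c%:R * sigma' (c * n)%N `^ k].

(* A formal series is given by its coefficients. *)
Definition formal_series (R : realType) (G : groupType) : Type := G -> R[i].

(* normc is the modulus with values in R rather than in R[i]. *)
Definition linf_norm (R : realType) (G : groupType) (L : G -> nat)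
  (sigma : nat -> R) (r : R) (b : formal_series R G) : \bar R :=
  ereal_sup [set (ComplexField.Normc.normc (b g) / sigma (L g) `^ r)%:E
            | g in [set: G]].

Definition basis_series (R : realType) (G : groupType) (g : G) :
  formal_series R G := fun h => (h == g)%:R.

Definition scale_series (R : realType) (G : groupType) (a : R[i])
  (b : formal_series R G) : formal_series R G := fun h => a * b h.

(* The family of terms, indexed by g, of the complete growth function at z. *)
Definition complete_growth_term (R : realType) (G : groupType) (L : G -> nat)
  (z : R[i]) (g : G) : formal_series R G :=
  scale_series (z ^+ L g) (basis_series R g).

Definition converges_absolutely (R : realType) (V : Type) (I : choiceType)
  (N : V -> \bar R) (f : I -> V) : Prop :=
  (\esum_(i in [set: I]) N (f i) < +oo)%E.

(* Main.v *)
Require Import Defs.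
From HB Require Import structures.
From mathcomp Require Import all_boot all_order all_algebra.
From mathcomp Require Import finmap.
From mathcomp Require Import all_classical all_reals all_analysis.
From mathcomp Require Import complex.
From mathcomp Require Import ring lra.

(** Since [|z| <= 1], the norm of [e_g z^(L g)] is at most its value
    [sigma (L g) ^ -r] at [z = 1], so (ii) says that [sigma (L g) ^ -r] is
    summable over [G] for some [r]. If the sum is [C], its restriction to the
    ball of radius [n] gives [beta n <= C * sigma n ^ r]. Conversely, almost
    submultiplicativity absorbs dilations of the argument into powers, so that
    [beta n <= A * sigma n ^ p] and [1 + n <= B * sigma n ^ q]; with
    [r = p + 2 q] the sum over spheres is dominated by
    [A B^2 sum_n (1 + n)^-2]. *)

Import Order.TTheory GRing.Theory Num.Theory.

Local Open Scope classical_set_scope.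
Local Open Scope ring_scope.
Local Open Scope complex_scope.

(** * Growth functions: trading dilations for powers *)

Section GrowthFunctions.
Context {R : realType}.
Implicit Types (f sigma : nat -> R).

Lemma growth_function_gt0 {sigma} : growth_function sigma ->
  forall n, 0 < sigma n.
Proof. by case=> h _ _ n; exact: lt_le_trans (h n). Qed.

Lemma growth_function_homo {sigma} : growth_function sigma ->
  {homo sigma : m n / (m <= n)%N >-> m <= n}.
Proof. by case=> _ h _; apply: homo_leq => //; exact: le_trans. Qed.

(** Induction on [c]: split [(c + 1) n] as [n + c n], apply almost submultiplicativity with
    [eps = 1], and bound the second factor by induction. The exponent [p] becomes [2 + 2 p]. *)
Lemma dilation_le_powR {sigma} : growth_function sigma ->
  almost_submultiplicative sigma -> forall c : nat, exists C p : R,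
  [/\ 0 <= C, 0 <= p & forall n, sigma (c * n)%N <= C * sigma n `^ p].
Proof.
move=> gs sub; elim=> [|c [C [p [C0 p0 Cp]]]].
  exists (sigma 0), 0; split=> // [|n]; first exact/ltW/growth_function_gt0.
  by rewrite mul0n powRr0 mulr1.
have [d [d0 hd]] := sub 1 ltr01.
exists (d * C `^ (1 + 1)), ((1 + 1) + p * (1 + 1)); split.
- by rewrite mulr_ge0 ?powR_ge0// ltW.
- by rewrite addr_ge0 ?mulr_ge0.
move=> n; rewrite mulSn; apply: (le_trans (hd n (c * n)%N)).
rewrite (@powRD _ _ (1 + 1)); last first.
  by rewrite (gt_eqF (growth_function_gt0 gs n)) implybT.
rewrite powRrM -!mulrA ler_wpM2l ?(ltW d0)// mulrCA ler_wpM2l ?powR_ge0//.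
rewrite -powRM ?powR_ge0// ge0_ler_powR// nnegrE.
  exact/ltW/growth_function_gt0.
by rewrite mulr_ge0 ?powR_ge0.
Qed.

Lemma growth_le_powR {f sigma} : growth_function sigma ->
  almost_submultiplicative sigma -> growth_le f sigma -> exists A p : R,
  [/\ 0 <= A, 0 <= p & forall n, f n <= A * sigma n `^ p].
Proof.
move=> gs sub [c [k [c1 k1 fc]]].
have [C [p [C0 p0 Cp]]] := dilation_le_powR gs sub c.
have k0 : 0 <= k by exact: le_trans k1.
exists (c%:R * C `^ k), (p * k); split; [|exact: mulr_ge0|].
  by rewrite mulr_ge0 ?powR_ge0.
move=> n; apply: (le_trans (fc n)).
rewrite powRrM -mulrA ler_wpM2l// -powRM ?powR_ge0// ge0_ler_powR// nnegrE.
  exact/ltW/growth_function_gt0.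
by rewrite mulr_ge0 ?powR_ge0.
Qed.

Lemma powR_growth_le {f sigma} {C r : R} : growth_function sigma -> 0 <= r ->
  (forall n, f n <= C * sigma n `^ r) -> growth_le f sigma.
Proof.
move=> gs r0 fC; have [s1 _ _] := gs.
(* [growth_le] asks for a positive integer constant and an exponent at least 1. Raising both is
   harmless because [sigma >= 1], and the dilation by the constant is harmless because [sigma] is
   monotone. *)
exists (Num.trunc C).+1, (Num.max 1 r); split=> //.
  by rewrite le_max lexx.
move=> n; apply: (le_trans (fC n)); apply: (@le_trans _ _
    ((Num.trunc C).+1%:R * sigma n `^ r)).
  by rewrite ler_wpM2r ?powR_ge0// ltW// truncnS_gt.
rewrite ler_wpM2l//; apply: (@le_trans _ _ (sigma n `^ (Num.max 1 r))).
  by rewrite ler_powR// le_max lexx orbT.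
rewrite ge0_ler_powR ?nnegrE ?(ltW (growth_function_gt0 gs _))//.
  by rewrite le_max ler01.
by apply: growth_function_homo => //; rewrite leq_pmull.
Qed.

End GrowthFunctions.

(** * Finite sums: inverse squares and grouping by length *)

Lemma sum_inv_sqr_le (R : realFieldType) (N : nat) :
  \sum_(n < N) (1 + n%:R : R) ^- 2 <= 2.
Proof.
(* The bound 2 alone is not inductive; with the correction term, an equality at [N = 0], each
   increment of the right side dominates the next summand. *)
suff: \sum_(n < N) (1 + n%:R : R) ^- 2 <= 2 - 2 / (1 + N%:R).
  move/le_trans; apply; rewrite gerBl divr_ge0// addr_ge0//.
elim: N => [|N IH]; first by rewrite big_ord0 addr0 divr1 subrr.
rewrite big_ord_recr /= -(@natr1 _ N).
set x : R := N%:R in IH *; have x0 : 0 <= x by rewrite /x.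
apply: (le_trans (lerD IH (lexx _))).
rewrite -subr_ge0.
have -> : 2 - 2 / (1 + (x + 1)) - (2 - 2 / (1 + x) + (1 + x) ^- 2) =
    x / ((1 + x) ^+ 2 * (1 + (x + 1))).
  by field; rewrite !lt0r_neq0//; lra.
by rewrite divr_ge0// mulr_ge0 ?sqr_ge0//; lra.
Qed.

(** Group the sum by the value of [L]: the elements of [X] with value [n] lie in [B n]. With balls
    for [B], spheres are counted by the balls containing them. *)
Lemma sum_fiber_le (R : numDomainType) (T : choiceType) (X : {fset T})
    (L : T -> nat) (w : nat -> R) (N : nat) (B : nat -> {fset T}) :
  (forall x, x \in X -> (L x < N)%N) -> (forall n, 0 <= w n) ->
  (forall x, x \in B (L x)) ->
  \sum_(x <- X) w (L x) <= \sum_(n < N) w n * #|` B n|%:R.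
Proof.
move=> XN w0 LB.
have -> : \sum_(x <- X) w (L x) =
    \sum_(x <- X) \sum_(n < N) if L x == n then w n else 0.
  rewrite big_seq [RHS]big_seq; apply: eq_bigr => x xX.
  by rewrite -big_mkcond (big_pred1 (Ordinal (XN x xX))).
rewrite exchange_big; apply: ler_sum => n _.
rewrite -big_mkcond big_const_seq iter_addr_0 -[leLHS]mulr_natr.
rewrite ler_wpM2l// ler_nat -size_filter uniq_leq_size ?filter_uniq// => x.
by rewrite mem_filter => /andP[/eqP<- _].
Qed.

(** * Word length and finiteness of balls *)

Section WordLength.
Context {G : groupType} {S : {fset G}}.
Implicit Types (g h : G) (m n : nat).

Lemma spelled1 : spelled S 1%g 0.
Proof. by exists [::]; split=> //; rewrite big_nil. Qed.

Lemma spelled_mul {g h m n} : spelled S g m -> spelled S h n ->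
  spelled S (g * h)%g (m + n).
Proof.
move=> [v [<- vS <-]] [w [<- wS <-]]; exists (v ++ w).
split; rewrite ?size_cat ?big_cat// => x.
by rewrite mem_cat => /orP[/vS|/wS].
Qed.

Lemma spelled_gen {g} : g \in S -> spelled S g 1.
Proof.
move=> gS; exists [:: g]; split=> //; last by rewrite big_seq1.
by move=> x; rewrite inE => /eqP->.
Qed.

Lemma spelled_inv {g n} : symmetric_set S -> spelled S g n ->
  spelled S (g^-1)%g n.
Proof.
move=> sym [w [<- + <-]]; elim: w => [|x w IH] wS.
  by rewrite big_nil invg1; exact: spelled1.
rewrite big_cons invgM /= -addn1; apply: spelled_mul.
  by apply: IH => y yw; apply: wS; rewrite inE yw orbT.
by apply: spelled_gen; rewrite sym; apply: in_imfset; apply: wS;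
  rewrite mem_head.
Qed.

(** The elements that have a spelling form a subgroup containing [S]; symmetry of [S] gives closure
    under inverses. *)
Lemma spelled_generates : symmetric_set S -> generates S ->
  forall g, exists n, spelled S g n.
Proof.
move=> sym gen g.
suff: smallest (@is_subgroup G) [set` S] `<=` [set g | exists n, spelled S g n].
  by apply; rewrite gen.
apply: smallest_sub => [|x xS]; last by exists 1%N; exact: spelled_gen.
split=> [|x y [m xm] [n yn]|x [n xn]]; first by exists 0; exact: spelled1.
  by exists (m + n)%N; exact: spelled_mul.
by exists n; exact: spelled_inv.
Qed.

Lemma spelled_word_length : symmetric_set S -> generates S ->
  forall g, spelled S g (word_length S g).
Proof.
move=> sym gen g; rewrite /word_length; case: xgetP => [n _ []//|none].
(* The default value of [xget] is excluded: some spelling exists, so there is one of least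
   length. *)
have ex : exists n, `[< spelled S g n >].
  by have [n gn] := spelled_generates sym gen g; exists n; exact/asboolP.
case: (ex_minnP ex) => m /asboolP gm mmin; case: (none m); split=> // n gn.
by apply: mmin; exact/asboolP.
Qed.

Lemma finite_spelled n : finite_set [set g | spelled S g n].
Proof.
elim: n => [|n IH].
  apply: (sub_finite_set _ (finite_set1 1%g)) => g [w [/size0nil -> _ <-]].
  by rewrite big_nil.
apply: (sub_finite_set _
  (finite_image2 (fun x y => (x * y)%g) (finite_fset S) IH)).
move=> g [[|x w] [//= [sw] wS <-]].
exists x; first by apply: wS; rewrite mem_head.
exists (\prod_(y <- w) y)%g; last by rewrite big_cons.
by exists w; split=> // y yw; apply: wS; rewrite inE yw orbT.
Qed.

Lemma finite_ball n : symmetric_set S -> generates S ->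
  finite_set [set g | (word_length S g <= n)%N].
Proof.
move=> sym gen.
have fin : finite_set (\bigcup_(m in `I_n.+1) [set g | spelled S g m]).
  by apply: bigcup_finite => // m _; exact: finite_spelled.
apply: (sub_finite_set _ fin) => g gn.
by exists (word_length S g) => //; exact: spelled_word_length.
Qed.

End WordLength.

(** * Norms of the terms and absolute convergence *)

Section Norm.
Context {R : realType} {G : groupType}.
Implicit Types (L : G -> nat) (sigma : nat -> R) (z : R[i]) (r : R).

Lemma normcX z n : ComplexField.Normc.normc (z ^+ n) =
  ComplexField.Normc.normc z ^+ n.
Proof.
elim: n => [|n IH]; first by rewrite !expr0 ComplexField.Normc.normc1.
by rewrite !exprS ComplexField.Normc.normcM IH.
Qed.

Lemma normc_ge0 z : 0 <= ComplexField.Normc.normc z.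
Proof. by case: z => a b; rewrite sqrtr_ge0. Qed.

(** The only nonzero coefficient of the term sits at [g], so the supremum is attained there. *)
Lemma linf_norm_complete_growth_term L sigma r z g :
  linf_norm L sigma r (complete_growth_term L z g) =
  (ComplexField.Normc.normc z ^+ L g / sigma (L g) `^ r)%:E.
Proof.
apply/eqP; rewrite eq_le; apply/andP; split.
  apply: ge_ereal_sup => _ [h _ <-]; rewrite lee_fin.
  rewrite /complete_growth_term /scale_series /basis_series.
  have [->|_] := eqVneq h g; first by rewrite mulr1 normcX.
  rewrite mulr0 ComplexField.Normc.normc0 mul0r.
  by rewrite divr_ge0 ?powR_ge0 ?exprn_ge0 ?normc_ge0.
apply: ereal_sup_ubound; exists g => //.
by rewrite /complete_growth_term /scale_series /basis_series eqxx mulr1 normcX.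
Qed.

Lemma converges_absolutely_bound L sigma r (C : R) :
  (forall X : {fset G}, \sum_(g <- X) (sigma (L g) `^ r)^-1 <= C) ->
  forall z, ComplexField.Normc.normc z <= 1 ->
    converges_absolutely (linf_norm L sigma r) (complete_growth_term L z).
Proof.
move=> XC z z1; apply: (@le_lt_trans _ _ C%:E); last exact: ltry.
apply: ge_ereal_sup => _ [A [Afin _] <-].
rewrite fsbig_finite//; under eq_bigr do rewrite linf_norm_complete_growth_term.
rewrite sumEFin lee_fin; apply: (le_trans _ (XC (fset_set A))).
apply: ler_sum => g _; rewrite -[leRHS]mul1r.
by rewrite ler_wpM2r ?invr_ge0 ?powR_ge0// exprn_ile1 ?normc_ge0.
Qed.

Lemma bound_converges_absolutely {L sigma r} :
  converges_absolutely (linf_norm L sigma r) (complete_growth_term L 1) ->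
  exists C : R,
    forall X : {fset G}, \sum_(g <- X) (sigma (L g) `^ r)^-1 <= C.
Proof.
rewrite /converges_absolutely.
under eq_esum do
  rewrite linf_norm_complete_growth_term ComplexField.Normc.normc1 expr1n mul1r.
set E := esum _ _ => Eoo.
have E0 : (0 <= E)%E.
  by apply: esum_ge0 => g _; rewrite lee_fin invr_ge0 powR_ge0.
(* [fine E] is the true sum, as [E] is nonnegative and finite; it bounds every finite partial
   sum. *)
exists (fine E) => X; rewrite -lee_fin fineK ?ge0_fin_numE// -sumEFin.
apply: esum_ge; exists [set` X]; first by split=> //; exact: finite_fset.
by rewrite fsbig_finite ?set_fsetK//; exact: finite_fset.
Qed.

End Norm.

(** * The two implications *)

(** By monotonicity each element of the ball of radius [n] contributes at least [sigma n ^ -r] to a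
    sum bounded by [C]. *)
Lemma volume_growth_le_of_summable {R : realType} {G : groupType}
    {S : {fset G}} {sigma : nat -> R} {r C : R} :
  growth_function sigma -> 0 <= r ->
  (forall X : {fset G}, \sum_(g <- X) (sigma (word_length S g) `^ r)^-1 <= C) ->
  forall n, volume_growth R S n <= C * sigma n `^ r.
Proof.
move=> gs r0 XC n; have s0 := growth_function_gt0 gs.
rewrite -ler_pdivrMr ?powR_gt0// /volume_growth.
set B := fset_set _; apply: (le_trans _ (XC B)).
rewrite -sum1_size natr_sum mulr_suml big_seq [leRHS]big_seq.
apply: ler_sum => g gB; rewrite mul1r lef_pV2 ?posrE ?powR_gt0//.
rewrite ge0_ler_powR ?nnegrE ?(ltW (s0 _))//; apply: growth_function_homo => //.
move: gB; rewrite /B.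
set A := [set _ | _].
(* [fset_set] of an infinite ball is the junk value [fset0], so no finiteness
   of balls is needed here. *)
have [Afin|Ainf] := pselect (finite_set A).
  by rewrite in_fset_set// inE.
by rewrite /fset_set; case: pselect => // Afin; case: (Ainf Afin).
Qed.

(** In the exponent, [p] cancels the growth of the balls and [2 q] leaves a factor of order
    [(1 + n) ^ -2], which is summable. *)
Lemma summable_of_volume_growth_le {R : realType} {G : groupType}
    {S : {fset G}} {sigma : nat -> R} {A p B q : R} :
  symmetric_set S -> generates S -> growth_function sigma ->
  0 <= A -> (forall n, volume_growth R S n <= A * sigma n `^ p) ->
  0 <= B -> (forall n, 1 + n%:R <= B * sigma n `^ q) ->
  forall X : {fset G},
    \sum_(g <- X) (sigma (word_length S g) `^ (p + q * 2%:R))^-1 <=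
    A * B ^+ 2 * 2.
Proof.
move=> sym gen gs A0 volA B0 linB X; have s0 := growth_function_gt0 gs.
pose N := (\max_(g <- X) word_length S g).+1.
pose ball n := fset_set [set g : G | (word_length S g <= n)%N].
apply: (le_trans (@sum_fiber_le _ _ _ _
    (fun n => (sigma n `^ (p + q * 2%:R))^-1) N ball _ _ _)).
- by move=> g gX; rewrite ltnS; apply: leq_bigmax_seq.
- by move=> n; rewrite invr_ge0 powR_ge0.
- by move=> g; rewrite in_fset_set ?inE//=; exact: finite_ball.
apply: (@le_trans _ _ (\sum_(n < N) A * B ^+ 2 * (1 + n%:R) ^- 2)); last first.
  by rewrite -mulr_sumr ler_wpM2l ?sum_inv_sqr_le// mulr_ge0 ?exprn_ge0.
apply: ler_sum => n _.
rewrite mulrC ler_pdivrMr ?powR_gt0//; apply: (le_trans (volA n)).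
rewrite powRD ?(gt_eqF (s0 n)) ?implybT//.
rewrite powRrM powR_mulrn ?powR_ge0//.
(* The factor split off on the right is at least 1, by the square of [linB]. *)
rewrite -!mulrA ler_wpM2l// [leRHS](_ : _ = sigma n `^ p *
  ((B * sigma n `^ q) ^+ 2 / (1 + n%:R) ^+ 2)); last by ring.
rewrite ler_peMr ?powR_ge0// ler_pdivlMr ?exprn_gt0 ?ltr_wpDr// mul1r.
by rewrite ler_sqr ?nnegrE ?mulr_ge0 ?powR_ge0.
Qed.

Theorem theorem9p1 (R : realType) (G : groupType) (S : {fset G})
    (sigma : nat -> R)
    (S_sym : symmetric_set S)
    (S_gen : generates S)
    (G_infinite : infinite_set [set: G])
    (sigma_growth : growth_function sigma)
    (sigma_submul : almost_submultiplicative sigma)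
    (sigma_lin : growth_le (fun n : nat => 1 + n%:R) sigma) :
  growth_le (volume_growth R S) sigma <->
  exists r : R, 0 <= r /\
    forall z : R[i], ComplexField.Normc.normc z <= 1 ->
      converges_absolutely (linf_norm (word_length S) sigma r)
        (complete_growth_term (word_length S) z).
Proof.
split=> [vol|[r [r0 conv]]].
  have [A [p [A0 p0 volA]]] := growth_le_powR sigma_growth sigma_submul vol.
  have [B [q [B0 q0 linB]]] :=
    growth_le_powR sigma_growth sigma_submul sigma_lin.
  exists (p + q * 2%:R); split; first by rewrite addr_ge0 ?mulr_ge0.
  apply: converges_absolutely_bound.
  exact: (summable_of_volume_growth_le S_sym S_gen sigma_growth A0 volA B0
    linB).
(* At [z = 1] the norms of the terms are exactly [sigma (L g) ^ -r]. *)
have [|C XC] := bound_converges_absolutely (conv 1 _).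
  by rewrite ComplexField.Normc.normc1.
apply: (powR_growth_le sigma_growth r0).
exact: (volume_growth_le_of_summable sigma_growth r0 XC).
Qed.
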